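(* Let $n$ be a positive integer, $F_q$ the finite field with $q$ elements, and $R=M_n(F_q)$. Then $$|V(\varTheta(R))|=\sum_{i=0}^{n}\binom{n}{i}_q^2,$$ and for every vertex $(V,W)$ of $\varTheta(R)$, $$\deg^+((V,W))=\deg^-((V,W))=\sum_{i=0}^{\dim W}\binom{\dim W}{i}_q\binom{n}{i}_q.$$
   Context: For a finite unital ring $R$, define $a\sim b$ if and only if $a=bu=vb$ for some units $u,v\in R$; this is an equivalence relation, and $[a]$ denotes the class of $a$. $\varTheta(R)$ is the directed graph whose vertices are the classes $[a]$, $a\in R$, with a directed edge $[x]\to[y]$ ($[x]$, $[y]$ not necessarily distinct) if and only if $xy=0$ (this is well defined). For a finite field $F$, the vertices of $\varTheta(M_n(F))$ are identified with the ordered pairs $(V,W)$ of subspaces of $F^n$ with $\dim V+\dim W=n$ via the bijection $[A]\mapsto(\operatorname{im}A,\ker A)$; under this identification there is an edge $(V_1,W_1)\to(V_2,W_2)$ if and only if $V_2\subseteq W_1$. $\deg^+$ and $\deg^-$ denote outdegree and indegree (a loop counts once in each). $\binom{n}{k}_q$ is the $q$-binomial coefficient, i.e. the number of $k$-dimensional subspaces of $F_q^n$ (zero if $k>n$ or $k<0$). *)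

(* Defs.v *)
From HB Require Import structures.
From mathcomp Require Import all_boot all_order all_algebra.

Set Implicit Arguments.
Unset Strict Implicit.
Unset Printing Implicit Defensive.

Import GRing.Theory VectorInternalTheory.
Local Open Scope ring_scope.

HB.instance Definition _ (F : finFieldType) (vT : vectType F) :=
  [Countable of {vspace vT} by <:].
HB.instance Definition _ (F : finFieldType) (vT : vectType F) :=
  [Finite of {vspace vT} by <:].

(* The q-binomial coefficient for q = #|F|. *)
Definition qbinom (F : finFieldType) (n k : nat) : nat :=
  #|[set U : {vspace 'cV[F]_n} | \dim U == k]|.

Section Theta.

Variable R : finUnitRingType.
Implicit Types (a b : R) (x y : {set R}).

Definition assoc_rel a b : bool :=
  [exists u : R, (u \is a GRing.unit) && (a == b * u)] &&
  [exists v : R, (v \is a GRing.unit) && (a == v * b)].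

Definition assoc_class a : {set R} := [set b | assoc_rel a b].

Definition theta_vertices : {set {set R}} := [set assoc_class a | a : R].

(* Independent of the representatives: see theta_edge_class. *)
Definition theta_edge x y : bool :=
  [exists a in x, exists b in y, a * b == 0].

Definition outdeg x : nat := #|[set y in theta_vertices | theta_edge x y]|.

Definition indeg x : nat := #|[set y in theta_vertices | theta_edge y x]|.

Lemma assoc_relP a b :
  reflect (exists u v, [/\ u \is a GRing.unit, v \is a GRing.unit,
                           a = b * u & a = v * b])
          (assoc_rel a b).
Proof.
apply: (iffP andP) => [[/existsP[u /andP[Uu /eqP au]]]|[u [v [Uu Uv au av]]]].
  by case/existsP=> v /andP[Uv /eqP av]; exists u, v.
by split; apply/existsP; [exists u; rewrite Uu -au | exists v; rewrite Uv -av] => /=.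
Qed.

Lemma assoc_rel_equiv : equivalence_rel assoc_rel.
Proof.
have refl a : assoc_rel a a.
  by apply/assoc_relP; exists 1, 1; rewrite unitr1 mulr1 mul1r.
have sym a b : assoc_rel a b -> assoc_rel b a.
  case/assoc_relP=> u [v [Uu Uv au av]]; apply/assoc_relP; exists u^-1, v^-1.
  by rewrite !unitrV {1}au av mulrK // mulKr.
have trans a b c : assoc_rel a b -> assoc_rel b c -> assoc_rel a c.
  case/assoc_relP=> u [v [Uu Uv au av]] /assoc_relP[s [t [Us Ut bs bt]]].
  apply/assoc_relP; exists (s * u), (v * t).
  by rewrite !unitrMl // mulrA -bs -mulrA -bt.
move=> a b c; split=> [|ab]; first exact: refl.
by apply/idP/idP; apply: trans; first exact: sym.
Qed.

Lemma assoc_class_eq a b : (assoc_class a == assoc_class b) = assoc_rel a b.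
Proof.
apply/eqP/idP => [eq_ab|ab].
  have: b \in assoc_class b by rewrite inE (assoc_rel_equiv b b b).1.
  by rewrite -eq_ab inE.
by apply/setP=> c; rewrite !inE (assoc_rel_equiv a b c).2.
Qed.

Lemma theta_edge_class a b :
  theta_edge (assoc_class a) (assoc_class b) = (a * b == 0).
Proof.
apply/idP/eqP => [/existsP[c /andP[]]|ab0].
  rewrite inE => /assoc_relP[_ [v [_ _ _ ->]]] /existsP[d /andP[]].
  rewrite inE => /assoc_relP[u [_ [_ _ -> _]]] /eqP cd0.
  by rewrite -mulrA (mulrA c) cd0 mul0r mulr0.
apply/existsP; exists a; rewrite inE (assoc_rel_equiv a a a).1 /=.
apply/existsP; exists b; rewrite inE (assoc_rel_equiv b b b).1 /=.
exact/eqP.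
Qed.

End Theta.

Section Matrices.

Variables (F : finFieldType) (m : nat).
Local Notation n := m.+1.
Implicit Types (A B : 'M[F]_n) (V W : {vspace 'cV[F]_n}).

(* Matrices act on column vectors from the left, so the library's row-space
   notions (kermx, submx) are not the ones wanted here. *)
Definition mx_im A : {vspace 'cV[F]_n} :=
  limg (linfun (mulmx A : 'cV[F]_n -> 'cV[F]_n)).

Definition mx_ker A : {vspace 'cV[F]_n} :=
  lker (linfun (mulmx A : 'cV[F]_n -> 'cV[F]_n)).

(* The set x is the vertex [A] identified with the pair (V, W) =
   (im A, ker A).  This is a bijection between theta_vertices and the pairs
   with \dim V + \dim W = n: see mx_im_ker_dim, assoc_class_mx_eq and
   mx_im_ker_surj. *)
Definition vertex_pair (x : {set 'M[F]_n}) V W : Prop :=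
  exists A, [/\ x = assoc_class A, V = mx_im A & W = mx_ker A].

Lemma mem_mx_ker A (v : 'cV[F]_n) : (v \in mx_ker A) = (A *m v == 0).
Proof. by rewrite memv_ker lfunE. Qed.

Lemma mem_mx_imP A (v : 'cV[F]_n) :
  reflect (exists w : 'cV[F]_n, v = A *m w) (v \in mx_im A).
Proof.
apply: (iffP idP) => [/memv_imgP[w _ ->]|[w ->]].
  by exists w; rewrite lfunE.
by apply/memv_imgP; exists w; rewrite ?memvf ?lfunE.
Qed.

Lemma mx_im_ker_dim A : (\dim (mx_im A) + \dim (mx_ker A) = n)%N.
Proof.
rewrite addnC -[mx_ker A]capfv limg_ker_dim dimvf /dim /=.
exact: muln1.
Qed.

Lemma mx_im_subP A B :
  reflect (exists X : 'M[F]_n, A = B *m X) (mx_im A <= mx_im B)%VS.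
Proof.
apply: (iffP subvP) => [sAB|[X ->] v /mem_mx_imP[w ->]]; last first.
  by apply/mem_mx_imP; exists (X *m w); rewrite mulmxA.
have /fin_all_exists[f fE] j : exists w : 'cV[F]_n, col j A = B *m w.
  by apply/mem_mx_imP/sAB/mem_mx_imP; exists (delta_mx j 0); rewrite colE.
pose X : 'M[F]_n := \matrix_(i, j) f j i 0.
exists X; apply/matrixP=> i j.
have colX : f j = col j X by apply/colP=> k; rewrite !mxE.
have /colP/(_ i) : col j A = col j (B *m X).
  by rewrite fE colX !colE mulmxA.
by rewrite 2!mxE.
Qed.

Lemma mx_ker_sub A B : (mx_ker B <= mx_ker A)%VS -> (A <= B)%MS.
Proof.
move=> /subvP sBA; rewrite submxE; apply/eqP/matrixP=> i j.
have : col j (cokermx B) \in mx_ker A.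
  apply: sBA; rewrite mem_mx_ker colE mulmxA mulmx_coker mul0mx //.
by rewrite mem_mx_ker colE mulmxA -colE => /eqP/colP/(_ i); rewrite 3!mxE => ->; rewrite mxE.
Qed.

Lemma assoc_class_mx_eq A B :
  (assoc_class A == assoc_class B) =
  (mx_im A == mx_im B) && (mx_ker A == mx_ker B).
Proof.
rewrite assoc_class_eq; apply/assoc_relP/andP => [|[/eqP imE /eqP kerE]].
  case=> u [v [Uu Uv Au Av]]; split; apply/eqP.
    apply/eqP; rewrite eqEsubv; apply/andP; split; apply/mx_im_subP.
      by exists u.
    by exists u^-1; rewrite [LHS](_ : B = A * u^-1) // Au mulrK.
  apply/vspaceP=> w; rewrite !mem_mx_ker Av -mulmxA.
  apply/eqP/eqP => [|->]; last by rewrite mulmx0.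
  by move/(congr1 (mulmx (invmx v))); rewrite mulKmx // mulmx0.
have /eqmxMunitP[v Uv Av] : (A == B)%MS.
  by rewrite !mx_ker_sub ?kerE.
have /mx_im_subP[X AX] : (mx_im A <= mx_im B)%VS by rewrite imE.
have /mx_im_subP[Y BY] : (mx_im B <= mx_im A)%VS by rewrite imE.
have /eqmxMunitP[u Uu Au] : (A^T == B^T)%MS.
  apply/andP; split; first by rewrite AX trmx_mul submxMl.
  by rewrite BY trmx_mul submxMl.
have Ut : u^T \in unitmx by rewrite unitmx_tr.
exists u^T, v; split=> //.
by apply: trmx_inj; rewrite Au trmx_mul trmxK.
Qed.

Lemma mx_im_ker_surj V W : (\dim V + \dim W = n)%N ->
  exists A, mx_im A = V /\ mx_ker A = W.
Proof.
move=> dimVW.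
have dimWC : (\dim (W^C) = \dim V)%N.
  have dimT : \dim {:'cV[F]_n} = (\dim V + \dim W)%N.
    by rewrite dimVW dimvf /dim /= muln1.
  by rewrite dimv_compl dimT addnK.
pose pi : 'End('cV[F]_n) := daddv_pi (W^C)%VS W.
have capWC : (W^C :&: W = 0)%VS by rewrite capvC capv_compl.
pose f (v : 'cV[F]_n) : 'cV[F]_n :=
  \sum_(i < \dim (W^C)) coord (vbasis (W^C)) i (pi v) *: (vbasis V)`_i.
have f_lin : linear f.
  move=> a u v; rewrite /f scaler_sumr -big_split; apply: eq_bigr => i _ /=.
  by rewrite !linearP /= scalerDl scalerA.
pose fl : {linear 'cV[F]_n -> 'cV[F]_n} :=
  HB.pack f (GRing.isLinear.Build _ _ _ _ f f_lin).
pose A : 'M[F]_n := \matrix_(i, j) fl (delta_mx j 0) i 0.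
have AE (v : 'cV[F]_n) : A *m v = f v.
  rewrite -[f v]/(fl v) [in RHS](matrix_sum_delta v) linear_sum /=.
  apply/colP=> i; rewrite !mxE summxE; apply: eq_bigr => j _.
  by rewrite big_ord1 -[f _]/(fl _) linearZ !mxE mulrC.
have kerA : mx_ker A = W.
  apply/vspaceP=> v; rewrite mem_mx_ker AE; apply/eqP/idP => [fv0|Wv].
    have coord0 i : coord (vbasis (W^C)) i (pi v) = 0.
      have freeV := basis_free (vbasisP V).
      have := coord_sum_free (fun k => coord (vbasis (W^C)) (cast_ord (esym dimWC) k) (pi v))
         (cast_ord dimWC i) freeV.
      rewrite cast_ordK => <-; rewrite -[RHS](linear0 (coord (vbasis V) (cast_ord dimWC i))).
      congr (coord _ _ _); rewrite -[RHS]fv0 /f (reindex (cast_ord dimWC)) /=.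
        by apply: eq_bigr => k _; rewrite cast_ordK.
      by exists (cast_ord (esym dimWC)) => k _; rewrite ?cast_ordK ?cast_ordKV.
    have pi0 : pi v = 0.
      rewrite (coord_vbasis (memv_pi _ _ v : pi v \in (W^C)%VS)) big1 // => i _.
      by rewrite coord0 scale0r.
    have <- : daddv_pi (W^C)%VS W v + daddv_pi W (W^C)%VS v = v.
      by apply: daddv_pi_add; rewrite // addvC addv_complf memvf.
    by rewrite -/pi pi0 add0r memv_pi.
  have pi0 : pi v = 0.
    have := @daddv_pi_add _ _ (W^C)%VS W v capWC.
    rewrite addvC addv_complf memvf => /(_ isT).
    rewrite -/pi (@daddv_pi_id _ _ W) ?capv_compl // => h.
    by apply: (addIr v); rewrite h add0r.
  by rewrite /f big1 // => i _; rewrite pi0 linear0 scale0r.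
exists A; split=> //; apply/eqP; rewrite eqEdim; apply/andP; split.
  apply/subvP=> v /mem_mx_imP[w ->]; rewrite AE; apply: memv_suml => i _.
  by apply/memvZ/vbasis_mem/mem_nth; rewrite size_tuple -dimWC.
by rewrite -(leq_add2r (\dim W)) dimVW -[in leqRHS]kerA mx_im_ker_dim.
Qed.

End Matrices.

(* Main.v *)
(** By the identification of the vertices with the pairs [(V, W)] such that
    [\dim V + \dim W = n], and since [AB = 0] amounts to [im B <= ker A], every
    quantity counts pairs of subspaces of complementary dimensions, one of them
    constrained to lie below [W] (outdegree) or above [V] (indegree).  The
    subspaces of [W] are those of the space of column vectors of size
    [\dim W], and [U |-> U^perp] exchanges the superspaces of [V] with the
    subspaces of [V^perp]; for [V = 0] this also gives the symmetry of the
    q-binomial coefficients. *)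

Require Import Defs.
From mathcomp Require Import all_boot all_order all_algebra.

Set Implicit Arguments.
Unset Strict Implicit.
Unset Printing Implicit Defensive.

Import GRing.Theory.

(** Both images are projections of the image of [a |-> (f a, g a)]; equal fibres make both
    projections injective on it. *)
Lemma card_imset_kernel (aT rT1 rT2 : finType) (f : aT -> rT1) (g : aT -> rT2)
    (D : {set aT}) :
  (forall a b, (f a == f b) = (g a == g b)) -> #|f @: D| = #|g @: D|.
Proof.
move=> fg; pose h a := (f a, g a).
have -> : f @: D = fst @: (h @: D) by rewrite -imset_comp.
have -> : g @: D = snd @: (h @: D) by rewrite -imset_comp.
rewrite (card_in_imset (f := fst)) ?(card_in_imset (f := snd)) //;
  move=> _ _ /imsetP[a _ ->] /imsetP[b _ ->] /= eq_ab.
- by congr (_, _) => //; apply/eqP; rewrite fg eq_ab.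
- by congr (_, _) => //; apply/eqP; rewrite -fg eq_ab.
Qed.

Section Subspaces.

Local Open Scope ring_scope.

Lemma qbinom_small (F : finFieldType) (n i : nat) :
  (n < i)%N -> qbinom F n i = 0%N.
Proof.
move=> lt_ni; apply/eqP; rewrite cards_eq0; apply/eqP/setP=> U; rewrite !inE.
apply/negbTE; rewrite neq_ltn (leq_ltn_trans _ lt_ni) //.
by rewrite (leq_trans (dimvS (subvf U))) // dimvf /dim /= muln1.
Qed.

Variables (F : finFieldType) (m : nat).
Local Notation n := m.+1.
Implicit Types (A B : 'M[F]_n) (U V W : {vspace 'cV[F]_n}).

Lemma card_subspaces W (i : nat) :
  #|[set U | (U <= W)%VS & \dim U == i]| = qbinom F (\dim W) i.
Proof.
(* The columns of [M] form a basis of [W], so [f] is an isomorphism of the coordinate space onto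
   [W], and [X |-> f @: X] matches subspaces dimension by dimension. *)
pose M : 'M[F]_(n, \dim W) := \matrix_(i, j) (vbasis W)`_j i 0.
pose f : 'Hom('cV[F]_(\dim W), 'cV[F]_n) :=
  linfun (mulmx M : 'cV[F]_(\dim W) -> 'cV[F]_n).
have fE v : f v = \sum_(j < \dim W) v j 0 *: (vbasis W)`_j.
  rewrite lfunE /=; apply/colP=> k; rewrite mxE summxE.
  by apply: eq_bigr => j _; rewrite !mxE mulrC.
have kerf : lker f == 0%VS.
  rewrite -subv0; apply/subvP=> v; rewrite memv_ker fE => /eqP fv0.
  rewrite memv0; apply/eqP/colP=> j; rewrite mxE.
  exact: (freeP (basis_free (vbasisP W)) (fun j => v j 0) fv0).
have imf : limg f = W.
  apply/eqP; rewrite eqEsubv; apply/andP; split.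
    apply/subvP=> _ /memv_imgP[v _ ->]; rewrite fE; apply: memv_suml => j _.
    by apply/memvZ/vbasis_mem/mem_nth; rewrite size_tuple.
  apply/subvP=> w Ww; apply/memv_imgP.
  exists (\col_j coord (vbasis W) j w); rewrite ?memvf // fE.
  by rewrite {1}(coord_vbasis Ww); apply: eq_bigr => j _; rewrite mxE.
have dimf X : \dim (f @: X)%VS = \dim X.
  by apply: limg_dim_eq; rewrite (eqP kerf) capv0.
have injf : injective (fun X => (f @: X)%VS).
  move=> X Y eqXY; apply/vspaceP=> v; have /lker0P finj := kerf.
  have memf (Z : {vspace 'cV[F]_(\dim W)}) : (v \in Z) = (f v \in (f @: Z)%VS).
    apply/idP/memv_imgP => [Zv|[w Zw /finj-> //]]; by exists v.
  by rewrite !memf eqXY.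
rewrite /qbinom -(card_imset _ injf); apply: eq_card => U; rewrite inE.
apply/andP/imsetP => [[sUW dimU]|[X]].
  exists (f @^-1: U)%VS; last by rewrite lpreimK ?imf.
  by rewrite inE -dimf lpreimK ?imf.
by rewrite inE -dimf => dimX ->; rewrite -{2}imf limgS ?subvf.
Qed.

Lemma mx_ker_unitmull A (X : 'M[F]_n) :
  X \in unitmx -> mx_ker (X *m A) = mx_ker A.
Proof.
move=> uX; apply/vspaceP=> v; rewrite !mem_mx_ker -mulmxA.
apply/eqP/eqP => [|->]; last by rewrite mulmx0.
by move/(congr1 (mulmx (invmx X))); rewrite mulKmx // mulmx0.
Qed.

Lemma mx_im_unitmulr A (X : 'M[F]_n) :
  X \in unitmx -> mx_im (A *m X) = mx_im A.
Proof.
move=> uX; apply/eqP; rewrite eqEsubv; apply/andP; split; apply/mx_im_subP.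
  by exists X.
by exists (invmx X); rewrite mulmxK.
Qed.

Lemma dim_mx_ker_unitmul A (X Y : 'M[F]_n) :
  X \in unitmx -> Y \in unitmx ->
  \dim (mx_ker (X *m A *m Y)) = \dim (mx_ker A).
Proof.
move=> uX uY; rewrite -mulmxA mx_ker_unitmull //.
(* Multiplication by [Y] on the right may move the kernel but keeps the image, so rank-nullity
   compares the kernel dimensions. *)
apply: (@addnI (\dim (mx_im (A *m Y)))).
by rewrite mx_im_ker_dim mx_im_unitmulr // mx_im_ker_dim.
Qed.

(* Row rank equals column rank: both matrices are equivalent to the same
   partial identity, which is symmetric. *)
Lemma dim_mx_ker_tr A : \dim (mx_ker A^T) = \dim (mx_ker A).
Proof.
have [uL uR] := (col_ebase_unit A, row_ebase_unit A).
rewrite -(mulmx_ebase A); move: (col_ebase A) (row_ebase A) uL uR => L R uL uR.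
move: (\rank A) => r; pose D : 'M[F]_n := pid_mx r.
have uLT : L^T \in unitmx by rewrite unitmx_tr.
have uRT : R^T \in unitmx by rewrite unitmx_tr.
have -> : (L *m D *m R)^T = R^T *m D *m L^T.
  by rewrite !trmx_mul tr_pid_mx mulmxA.
by rewrite (dim_mx_ker_unitmul D uRT uLT) (dim_mx_ker_unitmul D uL uR).
Qed.

(** Orthogonal for the dot product [u^T *m v]. Because of isotropic vectors it may meet [U]
    nontrivially; what counts is that it is an inclusion-reversing involution onto complementary
    dimensions. *)
Definition orthov U : {vspace 'cV[F]_n} :=
  (\bigcap_(u : 'cV[F]_n | u \in U)
     lker (linfun (mulmx u^T : 'cV[F]_n -> 'cV[F]_1)))%VS.

Lemma mem_orthovP U (v : 'cV[F]_n) :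
  reflect (forall u : 'cV[F]_n, u \in U -> u^T *m v = 0) (v \in orthov U).
Proof.
rewrite memvE; apply: (iffP subv_bigcapP) => Uv u /Uv.
  by rewrite -memvE memv_ker lfunE => /eqP.
by move=> uv; rewrite -memvE memv_ker lfunE /= uv.
Qed.

(** The rows of [A^T] are the transposed columns of [A], and these span the image of [A]. *)
Lemma orthov_mx_im A : orthov (mx_im A) = mx_ker A^T.
Proof.
apply/vspaceP=> v; rewrite mem_mx_ker; apply/mem_orthovP/eqP => [Av|Av u].
  apply/row_matrixP=> i; rewrite row0 row_mul -tr_col; apply: Av.
  by apply/mem_mx_imP; exists (delta_mx i 0); rewrite colE.
by case/mem_mx_imP=> w ->; rewrite trmx_mul -mulmxA Av mulmx0.
Qed.

Lemma dim_orthov U : (\dim U + \dim (orthov U) = n)%N.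
Proof.
have dimUC : (\dim U + \dim U^C = n)%N.
  rewrite dimv_compl subnKC ?dimvS ?subvf //.
  by rewrite dimvf /dim /= muln1.
(* Realising [U] as an image turns its orthogonal into the kernel of [A^T]; [U^C] merely supplies a
   kernel of the right dimension. *)
have [A [<- _]] := mx_im_ker_surj dimUC.
by rewrite orthov_mx_im dim_mx_ker_tr mx_im_ker_dim.
Qed.

Lemma orthovS U V : (U <= V)%VS -> (orthov V <= orthov U)%VS.
Proof.
move=> /subvP sUV; apply/subvP=> v /mem_orthovP Vv.
by apply/mem_orthovP=> u /sUV/Vv.
Qed.

(** Symmetry of the dot product puts [U] inside its double orthogonal; the dimension formula, used
    twice, forces equality. *)
Lemma orthovK : involutive orthov.
Proof.
move=> U; apply/esym/eqP; rewrite eqEdim; apply/andP; split.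
  apply/subvP=> u Uu; apply/mem_orthovP=> v /mem_orthovP/(_ u Uu) uv0.
  by apply: trmx_inj; rewrite trmx_mul trmxK uv0 trmx0.
rewrite -(leq_add2l (\dim (orthov U))) dim_orthov.
by rewrite addnC dim_orthov.
Qed.

(** The bound on [i] keeps [n - i] from truncating: for [V = 0] and [i > n] the left side would
    count the zero space, while the right side is 0. *)
Lemma card_superspaces V (i : nat) : (i <= n)%N ->
  #|[set U | (V <= U)%VS & \dim U == (n - i)%N]| = qbinom F (n - \dim V) i.
Proof.
move=> le_in; have -> : (n - \dim V = \dim (orthov V))%N.
  exact/esym/(canRL (addKn _))/dim_orthov.
rewrite -card_subspaces.
rewrite -(card_imset _ (inv_inj orthovK)); apply: eq_card => U.
apply/imsetP/idP => [[X] | ]; rewrite !inE => /andP[sV dimX].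
  move=> ->; rewrite orthovS //=.
  by rewrite -(eqn_add2l (\dim X)) dim_orthov (eqP dimX) subnK.
exists (orthov U); last by rewrite orthovK.
rewrite inE -{1}(orthovK V) orthovS //=.
by rewrite -(eqn_add2l (\dim U)) dim_orthov (eqP dimX) subnKC.
Qed.

Lemma card_complementary (P Q : pred {vspace 'cV[F]_n}) :
  #|[set p : {vspace 'cV[F]_n} * {vspace 'cV[F]_n} |
       (\dim p.1 + \dim p.2 == n)%N & P p.1 && Q p.2]|
  = (\sum_(0 <= i < n.+1) #|[set U | P U & \dim U == i]|
                         * #|[set U | Q U & \dim U == (n - i)%N]|)%N.
Proof.
rewrite big_mkord -sum1dep_card.
(* The pairs are sorted by the dimension of the first component; [inord] loses nothing, as this
   dimension is at most [n]. *)
rewrite (partition_big (fun p => inord (\dim p.1) : 'I_n.+1) xpredT) //=.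
apply: eq_bigr => i _; rewrite -cardsX sum1dep_card; apply: eq_card => -[U V].
rewrite !inE /=.
have dimU : (\dim U < n.+1)%N by rewrite ltnS -[leqRHS](dim_orthov U) leq_addr.
rewrite -val_eqE /= inordK //.
case: (\dim U =P i) => [<-|_]; last by rewrite !andbF.
by rewrite -(eqn_add2l (\dim U) _ (n - _)) subnKC // !andbT andbC andbA.
Qed.

Lemma card_theta_vertices (q : pred {set 'M[F]_n})
    (Q : pred ({vspace 'cV[F]_n} * {vspace 'cV[F]_n})) :
  (forall A, q (assoc_class A) = Q (mx_im A, mx_ker A)) ->
  #|[set y in theta_vertices 'M[F]_n | q y]|
  = #|[set p : {vspace 'cV[F]_n} * {vspace 'cV[F]_n} |
         (\dim p.1 + \dim p.2 == n)%N & Q p]|.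
Proof.
move=> qQ; pose D := [set A : 'M[F]_n | q (assoc_class A)].
transitivity #|[set assoc_class A | A in D]|.
  apply: eq_card => y; rewrite inE.
  apply/andP/imsetP => [[/imsetP[A _ ->] qA]|[A]].
    by exists A; rewrite ?inE.
  by rewrite inE => qA ->; split; first exact: imset_f.
transitivity #|[set (mx_im A, mx_ker A) | A in D]|.
  (* The class of [A] and the pair (image, kernel) determine each other, so the two maps have the
     same fibres. *)
  apply: card_imset_kernel => A B; exact: assoc_class_mx_eq.
apply: eq_card => -[V W]; rewrite inE /=.
apply/imsetP/andP => [[A]|[/eqP/mx_im_ker_surj[A [VA WA]] QVW]].
  by rewrite inE qQ => QA [-> ->]; rewrite mx_im_ker_dim.
by exists A; rewrite ?inE ?qQ VA WA.
Qed.

Lemma mulmx_eq0_im_ker A B : (A *m B == 0) = (mx_im B <= mx_ker A)%VS.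
Proof.
apply/eqP/subvP => [AB0 v /mem_mx_imP[w ->]|sBA].
  by rewrite mem_mx_ker mulmxA AB0 mul0mx.
apply/matrixP=> i j; have /sBA : col j B \in mx_im B.
  by apply/mem_mx_imP; exists (delta_mx j 0); rewrite colE.
by rewrite mem_mx_ker !colE mulmxA -colE => /eqP/colP/(_ i); rewrite !mxE.
Qed.

(** Sorting pairs by dimension gives a sum up to [n], whereas the degree formula stops at [\dim W];
    the extra terms vanish. *)
Lemma qbinom_sum_widen (k : nat) (G : nat -> nat) : (k <= n)%N ->
  (\sum_(0 <= i < n.+1) qbinom F k i * G i
   = \sum_(0 <= i < k.+1) qbinom F k i * G i)%N.
Proof.
move=> le_kn; rewrite (@big_cat_nat _ _ _ k.+1) //= [X in (_ + X)%N]big_nat_cond.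
rewrite [X in (_ + X)%N]big1 ?addn0 // => i /andP[/andP[lt_ki _] _].
by rewrite qbinom_small.
Qed.

End Subspaces.

(* The positive size of the matrices is n.+1. *)
Theorem proposition3p1 (F : finFieldType) (n : nat) :
  (#|theta_vertices 'M[F]_n.+1| = \sum_(0 <= i < n.+2) qbinom F n.+1 i ^ 2)%N /\
  (forall (x : {set 'M[F]_n.+1}) (V W : {vspace 'cV[F]_n.+1}),
     vertex_pair x V W ->
     outdeg x
       = (\sum_(0 <= i < (\dim W).+1) qbinom F (\dim W) i * qbinom F n.+1 i)%N /\
     indeg x
       = (\sum_(0 <= i < (\dim W).+1) qbinom F (\dim W) i * qbinom F n.+1 i)%N).
Proof.
have card_dim i : #|[set U : {vspace 'cV[F]_n.+1} | true & \dim U == i]|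
    = qbinom F n.+1 i by [].
have card_codim i : i < n.+2 ->
    #|[set U : {vspace 'cV[F]_n.+1} | true & \dim U == n.+1 - i]|
    = qbinom F n.+1 i.
  move=> lt_i; have := @card_superspaces F n 0%VS i lt_i.
  rewrite dimv0 subn0 => <-.
  by apply: eq_card => U; rewrite !inE sub0v.
split=> [|_ V W [A [-> _ ->]]].
  have := @card_theta_vertices F n predT predT (fun=> erefl).
  have -> : [set y in theta_vertices 'M[F]_n.+1 | predT y] = theta_vertices _.
    by apply/setP=> y; rewrite inE andbT.
  move=> ->; rewrite (card_complementary predT predT).
  apply: eq_big_nat => i /andP[_ lt_i].
  by rewrite card_dim card_codim // mulnn.
have dimA := mx_im_ker_dim A.
have le_ker : \dim (mx_ker A) <= n.+1 by rewrite -[leqRHS]dimA leq_addl.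
rewrite -(qbinom_sum_widen _ _ le_ker); split.
  rewrite /outdeg (@card_theta_vertices _ _ _
    (fun p => (p.1 <= mx_ker A)%VS && true)) => [|B]; last first.
    by rewrite theta_edge_class andbT -mulmx_eq0_im_ker.
  rewrite (card_complementary (fun U => U <= mx_ker A)%VS predT).
  apply: eq_big_nat => i /andP[_ lt_i].
  by rewrite card_subspaces card_codim.
(* An edge from the class of [B] to that of [A] puts the image of [A] inside the kernel of [B], so
   the constraint falls on the second component. *)
rewrite /indeg (@card_theta_vertices _ _ _
  (fun p => true && (mx_im A <= p.2)%VS)) => [|B]; last first.
  by rewrite theta_edge_class -mulmx_eq0_im_ker.
rewrite (card_complementary predT (fun U => mx_im A <= U)%VS).
apply: eq_big_nat => i /andP[_ lt_i].
(* The codimension of the image of [A] is the parameter produced by counting its superspaces of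
   codimension [i]. *)
have -> : \dim (mx_ker A) = n.+1 - \dim (mx_im A) by apply: canRL (addKn _) _.
by rewrite card_dim card_superspaces // mulnC.
Qed.
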